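(* Let $n \geq 1$ be an integer and let $\mathcal{H}=(V,E)$ be a finite $n$-uniform hypergraph that is not $2$-colorable. If $m_2(\mathcal{H}) = n\cdot\binom{2n-1}{n}$, then $\mathcal{H}$ contains a copy of $K_{2n-1}^n$, i.e. there is a set $U \subseteq V$ with $|U| = 2n-1$ such that every $n$-element subset of $U$ belongs to $E$.
   Context: A hypergraph $\mathcal{H}=(V,E)$ consists of a vertex set $V$ and a set $E$ of edges, each of which is a subset of $V$. It is $n$-uniform (an $n$-graph) if every edge has exactly $n$ elements. $\mathcal{H}$ is $2$-colorable if each vertex can be assigned one of two colors so that every edge contains vertices of both colors. A pair of edges $X, Y \in E$ is simple if $|X \cap Y| = 1$. $m_2(\mathcal{H})$ denotes the number of ordered simple pairs, i.e. the number of pairs $(X,Y) \in E \times E$ with $|X\cap Y| = 1$. $K_{2n-1}^n$ denotes the complete $n$-uniform hypergraph on $2n-1$ vertices, whose edges are all $n$-element subsets of its vertex set. *)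

(* Defs.v *)
From mathcomp Require Import all_boot.

Set Implicit Arguments.
Unset Strict Implicit.
Unset Printing Implicit Defensive.

(* A finite hypergraph is given by its vertex type V : finType together with
   its edge set E : {set {set V}}; there are no repeated edges. *)

Definition uniform (V : finType) (n : nat) (E : {set {set V}}) : Prop :=
  forall X : {set V}, X \in E -> #|X| = n.

Definition two_colorable (V : finType) (E : {set {set V}}) : Prop :=
  exists c : V -> bool, forall X : {set V}, X \in E ->
    (exists2 x, x \in X & c x = true) /\ (exists2 y, y \in X & c y = false).

(* X = Y is allowed, which matters only for edges of size 1. *)
Definition simple_pair (V : finType) (X Y : {set V}) : bool := #|X :&: Y| == 1.

Definition m2 (V : finType) (E : {set {set V}}) : nat :=
  #|[set p : {set V} * {set V} |
      [&& p.1 \in E, p.2 \in E & simple_pair p.1 p.2]]|.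

Definition contains_complete (V : finType) (k n : nat) (E : {set {set V}}) :
    Prop :=
  exists2 U : {set V}, #|U| = k &
    forall X : {set V}, X \subset U -> #|X| = n -> X \in E.

(* Main.v *)
Require Import Defs.
From mathcomp Require Import all_boot all_fingroup.
From mathcomp Require Import zify.

(* Order V uniformly at random and call a pair of edges meeting in a single
   vertex a chain when that vertex is last in the first edge and first in the
   second. By Pluhar's criterion every ordering has a chain. All simple pairs are
   chains with the same probability, and in K_{2n-1}^n every ordering has at most
   one chain; since m_2(H) = m_2(K_{2n-1}^n), every ordering has exactly one chain
   in H. If X, Y are edges with X /\ Y = {v} and x <> v lies in X, comparing an
   ordering V \ (Y + x) < v < x < Y - v with the one where v and x are swapped
   forces Y - v + x to be an edge. Iterating such exchanges turns X into any
   n-subset of X \/ Y. *)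

Set Implicit Arguments.
Unset Strict Implicit.
Unset Printing Implicit Defensive.

(** * Simple pairs and permutations matching prescribed fibres *)

Lemma simple_pairP (V : finType) (X Y : {set V}) :
  reflect (exists v, X :&: Y = [set v]) (simple_pair X Y).
Proof. exact: cards1P. Qed.

Lemma simple_pairC (V : finType) (X Y : {set V}) :
  simple_pair X Y = simple_pair Y X.
Proof. by rewrite /simple_pair setIC. Qed.

(** Equal fibre sizes make the value lists of [f] and [g] rearrangements of each other; the
    permutation of indices is carried to [V] along the enumeration. *)
Lemma perm_of_card_fibers (V : finType) (T : eqType) (f g : V -> T) :
  (forall t, #|[pred x | f x == t]| = #|[pred x | g x == t]|) ->
  exists p : {perm V}, forall x, g (p x) = f x.
Proof.
move=> fg; have perm_codom : perm_eq (codom f) (codom_tuple g).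
  apply/allP => t _ /=; rewrite !codomE !count_map; apply/eqP.
  by have := fg t; rewrite !cardE /enum_mem !size_filter -!enumT.
have [p pE] := tuple_permP perm_codom.
have qI : injective (fun x => enum_val (p (enum_rank x))).
  by move=> x y /enum_val_inj/perm_inj/enum_rank_inj.
exists (perm qI) => x; rewrite permE.
have := congr1 (fun l => nth (f x) l (enum_rank x)) pE.
rewrite /= nth_codom enum_rankK => ->.
by rewrite (nth_map (enum_rank x)) ?size_enum_ord // nth_ord_enum (tnth_nth (f x)) nth_codom.
Qed.

Lemma union_card n (V : finType) (X Y : {set V}) :
  #|X| = n -> #|Y| = n -> simple_pair X Y -> #|X :|: Y| = 2 * n - 1.
Proof. by move=> hX hY /eqP hXY; rewrite cardsU hX hY hXY; lia. Qed.

(** * Vertex orderings and their chains *)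

Section Orderings.
Variable V : finType.
Implicit Types (s : {perm V}) (X Y : {set V}) (E : {set {set V}}).

(** Orderings are encoded as permutations, so that relabelling vertices by [p] becomes the left
    multiplication [p * s]. *)
Definition rank s (x : V) : nat := enum_rank (s x).

Lemma rank_inj s : injective (rank s).
Proof. by move=> x y /ord_inj/enum_rank_inj/perm_inj. Qed.

(** The inequality is weak to allow a shared vertex: for a simple pair it says that this vertex is
    last in [X] and first in [Y]. *)
Definition before s X Y := [forall x in X, forall y in Y, rank s x <= rank s y].

Lemma beforeP s X Y :
  reflect {in X & Y, forall x y, rank s x <= rank s y} (before s X Y).
Proof.
apply: (iffP forall_inP) => [h x y xX yY | h x xX].
  exact: (forall_inP (h x xX)).
by apply/forall_inP => y yY; apply: h.
Qed.

Definition chain E s (p : {set V} * {set V}) :=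
  [&& p.1 \in E, p.2 \in E, simple_pair p.1 p.2 & before s p.1 p.2].

(** Sort the vertices by [f] and rank each one by its index in the sorted list; ties fall
    arbitrarily. *)
Lemma exists_ordering (f : V -> nat) :
  exists s, forall x y, f x < f y -> rank s x < rank s y.
Proof.
pose leT := relpre f leq; pose t := sort leT (enum V).
have tT x : x \in t by rewrite mem_sort mem_enum.
have ltI x : index x t < #|V| by rewrite cardE -(size_sort leT) index_mem.
have gI : injective (fun x => enum_val (Ordinal (ltI x))).
  by move=> x y /enum_val_inj[] /index_inj; apply.
exists (perm gI) => x y fxy; rewrite /rank !permE !enum_valK /=.
rewrite ltnNge; apply/negP => le_yx; move: fxy; rewrite ltnNge => /negP[].
suff: leT y x by [].
apply: (@sorted_leq_index _ leT _ _ t) => //.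
- by move=> ? ? ?; apply: leq_trans.
- by move=> ?; apply: leqnn.
- by apply: sort_sorted => a b; apply: leq_total.
Qed.

(* Pluhar's criterion: colour the vertices that are last in some edge. An edge
   never misses this colour, and if all of Y has it, then Y preceded by an edge
   ending in the first vertex of Y is a chain. *)
Lemma exists_chain n E s : 0 < n -> uniform n E -> ~ two_colorable E ->
  exists p, chain E s p.
Proof.
move=> n0 uE ncE.
pose lastof v := [exists X in E, (v \in X) && [forall x in X, rank s x <= rank s v]].
case: (pickP (chain E s)) => [p pE|noc]; first by exists p.
case: ncE; exists lastof => Y YE.
have [y yY] : exists y, y \in Y by apply/card_gt0P; rewrite (uE _ YE).
split.
  case: (@arg_maxnP _ y (mem Y) (rank s) yY) => x xY xm; exists x => //.
  by apply/exists_inP; exists Y => //; apply/andP; split=> //; apply/forall_inP.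
case: (@arg_minnP _ y (mem Y) (rank s) yY) => v vY vm; exists v => //.
apply/negbTE/negP => /exists_inP[X XE /andP[vX /forall_inP Xv]].
have := noc (X, Y); rewrite /chain /= XE YE /= => /negP[].
apply/andP; split; last first.
  by apply/beforeP => a b aX bY; apply: leq_trans (Xv _ aX) (vm _ bY).
apply/simple_pairP; exists v; apply/setP => u; rewrite !inE.
apply/andP/eqP => [[uX uY]|->] //.
by apply: (@rank_inj s); apply/eqP; rewrite eqn_leq (Xv _ uX) (vm _ uY).
Qed.

(** All simple pairs are chains equally often: some [p] carries [(X, Y)] to [(X', Y')], and [s] to
    [p * s] is then a bijection between the two sets of orderings. *)
Lemma simple_before_image n X Y X' Y' :
  #|X| = n -> #|Y| = n -> #|X'| = n -> #|Y'| = n ->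
  simple_pair X Y -> simple_pair X' Y' ->
  #|[set s | before s X Y]| = #|[set s | before s X' Y']|.
Proof.
move=> cX cY cX' cY' sXY sXY'.
pose ty (A B : {set V}) x := (x \in A, x \in B).
(* The four Venn regions of a simple pair have sizes depending only on [n] and [#|V|]. *)
have fib (A B : {set V}) t : #|A| = n -> #|B| = n -> simple_pair A B ->
    #|[pred x | ty A B x == t]| = match t with
      | (true, true) => 1 | (false, false) => #|V| - (2 * n - 1) | _ => n - 1 end.
  move=> cA cB sAB; have sBA := sAB; rewrite simple_pairC in sBA.
  case: t => [[] []].
  - rewrite -(eqP sAB); apply: eq_card => x; rewrite !inE /ty xpair_eqE.
    by rewrite !eqb_id.
  - rewrite -{}cA -(eqP sAB) -cardsD; apply: eq_card => x.
    by rewrite !inE /ty xpair_eqE eqb_id eqbF_neg andbC.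
  - rewrite -{}cB -(eqP sBA) -cardsD; apply: eq_card => x.
    by rewrite !inE /ty xpair_eqE eqb_id eqbF_neg.
  - rewrite -(union_card cA cB sAB) -(cardsC (A :|: B)) addKn; apply: eq_card => x.
    by rewrite !inE /ty xpair_eqE !eqbF_neg negb_or.
have [|p pE] := @perm_of_card_fibers V _ (ty X Y) (ty X' Y').
  by move=> t; rewrite !fib.
have pX x : (p x \in X') = (x \in X) by case: (pE x).
have pY x : (p x \in Y') = (x \in Y) by case: (pE x).
have bE s : before (p * s)%g X Y = before s X' Y'.
  have rE x : rank (p * s)%g x = rank s (p x) by rewrite /rank permM.
  apply/beforeP/beforeP => h a b aX bY; last by rewrite !rE h ?pX ?pY.
  by have := h (p^-1 a)%g (p^-1 b)%g; rewrite -pX -pY !rE !permKV; apply.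
rewrite -(card_imset [set s | before s X' Y'] (mulgI p)); apply: eq_card => s.
rewrite inE; apply/idP/imsetP => [h|[t]]; last by rewrite inE -bE => h ->.
by exists (p^-1 * s)%g; rewrite ?mulKVg // inE -bE mulKVg.
Qed.

End Orderings.

(** * Counting chains by comparison with the complete hypergraph *)

Definition complete (V : finType) n (U : {set V}) : {set {set V}} :=
  [set X : {set V} | X \subset U & #|X| == n].

Lemma complete_uniform (V : finType) n (U : {set V}) : uniform n (complete n U).
Proof. by move=> X; rewrite inE => /andP[_ /eqP]. Qed.

(** An edge [X] and a vertex [v] of it give the simple pair of [X] and [v |: (U :\: X)], from which
    [v] is recovered as the common vertex. *)
Lemma m2_complete_ge (V : finType) n (U : {set V}) :
  0 < n -> #|U| = 2 * n - 1 -> n * 'C(2 * n - 1, n) <= m2 (complete n U).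
Proof.
move=> n0 cU.
pose A := [set p : {set V} * V | (p.1 \in complete n U) && (p.2 \in p.1)].
have cA : #|A| = n * 'C(2 * n - 1, n).
  rewrite -cU -cards_draws -sum1_card.
  under eq_bigl => p do rewrite inE.
  rewrite -(pair_big_dep (fun X => X \in complete n U) (fun X v => v \in X)
    (fun _ _ => 1)) /=.
  under eq_bigr => X XE do rewrite sum1_card (complete_uniform XE).
  by rewrite sum_nat_const mulnC.
rewrite -cA -(@card_in_imset _ _ (fun p => (p.1, p.2 |: (U :\: p.1)))).
  apply/subset_leq_card/subsetP => q /imsetP[[X v]] /=; rewrite !inE /=.
  move=> /andP[/andP[XU /eqP cX] vX] -> /=; rewrite XU cX eqxx /=.
  have vU := subsetP XU v vX.
  rewrite subUset sub1set vU subsetDl /= cardsU1 !inE vX /= cardsD.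
  rewrite (setIidPr XU) cU cX; apply/andP; split; first by apply/eqP; lia.
  apply/simple_pairP; exists v; apply/setP => u; rewrite !inE.
  by case: eqVneq => [->|_]; rewrite ?vX //=; case: (u \in X).
move=> [X v] [X' v'] /=; rewrite !inE /= => /andP[_ vX] /andP[_ vX'] [eX].
subst X' => /setP/(_ v); rewrite !inE eqxx vX /= => /esym.
by rewrite orbF => /eqP->.
Qed.

(** By cardinality the two edges of a chain cover [U], so they must be the first [n] and the last
    [n] vertices of [U] in the ordering. *)
Lemma complete_chain_uniq (V : finType) n (U : {set V}) (s : {perm V}) :
  #|U| = 2 * n - 1 -> #|[set p | chain (complete n U) s p]| <= 1.
Proof.
move=> cU; apply/card_le1_eqP => -[X Y] [X' Y']; rewrite !inE /=.
have cov A B : chain (complete n U) s (A, B) ->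
  [/\ #|A| = n, #|B| = n, A :|: B = U & before s A B].
  rewrite /chain /= !inE => /and4P[/andP[AU /eqP cA] /andP[BU /eqP cB] sAB bAB].
  split=> //; apply/eqP; rewrite eqEcard subUset AU BU cU.
  by rewrite (union_card cA cB sAB) leqnn.
move=> /cov[cX cY eU bXY] /cov[cX' cY' eU' bXY'].
have cov1 x : x \in U -> (x \in X) || (x \in Y) by rewrite -eU inE.
have cov2 x : x \in U -> (x \in X') || (x \in Y') by rewrite -eU' inE.
have subU (A B C : {set V}) : A :|: B = C -> {subset A <= C} /\ {subset B <= C}.
  by move=> <-; split=> x xA; rewrite inE xA ?orbT.
have [sX sY] := subU _ _ _ eU; have [sX' sY'] := subU _ _ _ eU'.
have ne (A B : {set V}) : #|A| = n -> #|B| = n -> A != B ->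
    exists a b, [/\ a \in A, a \notin B, b \in B & b \notin A].
  move=> cA cB AB.
  have /subsetPn[a aA aB] : ~~ (A \subset B).
    by apply: contra AB => AB; rewrite eqEcard AB cA cB leqnn.
  have /subsetPn[b bB bA] : ~~ (B \subset A).
    by apply: contra AB => BA; rewrite eq_sym eqEcard BA cA cB leqnn.
  by exists a, b.
(* If X <> X', some a in X \ X' lies in Y' and some b in X' \ X lies in Y, so
   that a and b would precede each other; likewise if Y <> Y'. *)
congr pair; apply/esym/eqP; apply: contraT.
- move=> /(ne _ _ cX cX')[a [b [aX aX' bX' bX]]].
  have bY : b \in Y by have := cov1 b (sX' _ bX'); rewrite (negPf bX).
  have aY : a \in Y' by have := cov2 a (sX _ aX); rewrite (negPf aX').
  have := beforeP _ _ _ bXY _ _ aX bY; have := beforeP _ _ _ bXY' _ _ bX' aY.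
  move=> h1 h2; have e : a = b.
    by apply: (@rank_inj _ s); apply/eqP; rewrite eqn_leq h1 h2.
  by rewrite e bX' in aX'.
- move=> /(ne _ _ cY cY')[a [b [aY aY' bY' bY]]].
  have bX : b \in X by have := cov1 b (sY' _ bY'); rewrite (negPf bY) orbF.
  have aX : a \in X' by have := cov2 a (sY _ aY); rewrite (negPf aY') orbF.
  have := beforeP _ _ _ bXY _ _ bX aY; have := beforeP _ _ _ bXY' _ _ aX bY'.
  move=> h1 h2; have e : a = b.
    by apply: (@rank_inj _ s); apply/eqP; rewrite eqn_leq h1 h2.
  by rewrite e bY' in aY'.
Qed.

(** Double counting of pairs (ordering, chain): the total is at least one per ordering for [E], and
    at most the total for a complete hypergraph. *)
Lemma unique_chain n (V : finType) (E : {set {set V}}) (s : {perm V}) :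
  0 < n -> uniform n E -> ~ two_colorable E -> m2 E = n * 'C(2 * n - 1, n) ->
  #|[set p | chain E s p]| = 1.
Proof.
move=> n0 uE ncE mE.
(* Any ordering serves here: its chain supplies a vertex set [U] of size [2 * n - 1] inside [V], so
   that both hypergraphs share the same orderings, and a reference pair for the constant [c]. *)
have [[X Y] XYc] := exists_chain 1%g n0 uE ncE.
have /and4P[/= XE YE sXY _] := XYc.
have [cX cY] := (uE _ XE, uE _ YE).
pose U := X :|: Y; have cU : #|U| = 2 * n - 1 by apply: union_card.
pose c := #|[set s | before s X Y]|.
have count (F : {set {set V}}) :
    uniform n F -> \sum_s #|[set p | chain F s p]| = m2 F * c.
  move=> uF.
  under eq_bigr => t _ do rewrite -sum1dep_card.
  rewrite (exchange_big_dep (fun p =>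
    [&& p.1 \in F, p.2 \in F & simple_pair p.1 p.2])) /=; last first.
    by move=> t p _ /and4P[-> -> ->].
  rewrite /m2 -sum_nat_const; under [RHS]eq_bigl => p do rewrite inE.
  apply: eq_bigr => p /and3P[pF qF sp]; rewrite sum1dep_card.
  rewrite /c -(simple_before_image (uF _ pF) (uF _ qF) cX cY sp sXY).
  by apply: eq_card => t; rewrite !inE /chain pF qF sp.
have ge1 t : 0 < #|[set p | chain E t p]|.
  have [p pE] := exists_chain t n0 uE ncE.
  by apply/card_gt0P; exists p; rewrite inE.
have le : \sum_t #|[set p | chain E t p]| <= \sum_(t : {perm V}) 1.
  rewrite count // mE.
  apply: leq_trans (leq_mul (m2_complete_ge n0 cU) (leqnn c)) _.
  rewrite -count; last exact: complete_uniform.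
  by apply: leq_sum => t _; apply: complete_chain_uniq.
(* A second chain at [s] would push the total above the number of orderings. *)
apply/eqP; rewrite eqn_leq ge1 andbT leqNgt; apply/negP => gt1.
move: le; rewrite leqNgt => /negP[].
by rewrite (bigD1 s) //= [ltnRHS](bigD1 s) //= -addSn leq_add // leq_sum.
Qed.

(** * Exchanging vertices between the edges of a simple pair *)

Section Exchange.
Variables (n : nat) (V : finType) (E : {set {set V}}).
Hypothesis uE : uniform n E.
Hypothesis one_chain : forall s, #|[set p | chain E s p]| = 1.

Lemma chain_uniq s p q : chain E s p -> chain E s q -> p = q.
Proof.
move=> hp hq; have /eqP/cards1P[r rE] := one_chain s.
have : (p \in [set r]) && (q \in [set r]) by rewrite -rE !inE hp.
by rewrite !inE => /andP[/eqP-> /eqP->].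
Qed.

Lemma edge_exchange X Y v x :
  X \in E -> Y \in E -> X :&: Y = [set v] -> x \in X -> x != v ->
  x |: (Y :\ v) \in E.
Proof.
move=> XE YE XYv xX xv.
have [vX vY] : v \in X /\ v \in Y by apply/setIP; rewrite XYv inE.
have XY u : u \in X -> u \in Y -> u = v.
  by move=> uX uY; apply/set1P; rewrite -XYv inE uX.
have xY : x \notin Y by apply: contra xv => xY; apply/eqP/XY.
(* Only the order between the four levels matters. The test for [v] precedes that for [Y] because
   [v] lies in [Y]. *)
pose key u := if u == v then 1 else if u == x then 2 else if u \in Y then 3 else 0.
have [s sP] := exists_ordering key.
have ltvx : rank s v < rank s x.
  by apply: sP; rewrite /key eqxx (negPf xv) eqxx.
have ltxY u : u \in Y -> u != v -> rank s x < rank s u.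
  move=> uY uv; apply: sP; rewrite /key eqxx (negPf xv) (negPf uv) uY.
  by case: eqVneq uY => // ->; rewrite (negPf xY).
have lt0v u : u \notin Y -> u != x -> rank s u < rank s v.
  move=> uY ux; apply: sP; rewrite /key eqxx (negPf ux) (negPf uY).
  by case: eqVneq uY => // ->; rewrite vY.
pose s' := (tperm v x * s)%g.
have r'E u : rank s' u = rank s (tperm v x u) by rewrite /rank permM.
have r'v : rank s' v = rank s x by rewrite r'E tpermL.
have r'x : rank s' x = rank s v by rewrite r'E tpermR.
have r'o u : u != v -> u != x -> rank s' u = rank s u.
  by move=> uv ux; rewrite r'E tpermD // eq_sym.
(* After the swap [v] sits at the old place of [x]: all of [X] lies at or below it, and all of [Y]
   at or above. *)
have chXY : chain E s' (X, Y).
  rewrite /chain /= XE YE /=; apply/andP; split; first by apply/simple_pairP; exists v.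
  apply/beforeP => a b aX bY.
  have h1 : rank s' a <= rank s x.
    have [->|av] := eqVneq a v; first by rewrite r'v.
    have [->|ax] := eqVneq a x; first by rewrite r'x ltnW.
    rewrite r'o //; apply/ltnW/(ltn_trans _ ltvx)/lt0v => //.
    by apply: contra av => aY; apply/eqP/XY.
  apply: leq_trans h1 _; have [->|bv] := eqVneq b v; first by rewrite r'v.
  rewrite r'o //; first exact/ltnW/ltxY.
  by apply: contraNneq xY => <-.
have [[X' Y'] XY'] : exists p, chain E s p.
  have /eqP/cards1P[p pE] := one_chain s; exists p.
  by have := set11 p; rewrite -pE inE.
have /and4P[/= X'E Y'E sp' /beforeP bXY'] := XY'.
have [c cE] := simple_pairP _ _ sp'.
have [cX' cY'] : c \in X' /\ c \in Y' by apply/setIP; rewrite cE inE.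
have X'le u : u \in X' -> rank s u <= rank s c by move=> uX; apply: bXY'.
have Y'ge u : u \in Y' -> rank s c <= rank s u by move=> uY; apply: bXY'.
(* (X, Y) is a chain for s', hence the only one: if c = v, then (X', Y) is another
   one; if c = x, then Y' is the desired edge; otherwise (X', Y') remains a chain
   for s'. *)
have [ecv|cv] := eqVneq c v.
  subst c.
  have xX' : x \notin X' by apply/negP => /X'le; rewrite leqNgt ltvx.
  suff /(chain_uniq chXY)[eX] : chain E s' (X', Y) by rewrite -eX xX in xX'.
  have X'Y u : u \in X' -> u \in Y -> u = v.
    move=> uX uY; apply: contraTeq (X'le _ uX) => uv; rewrite -ltnNge.
    exact: ltn_trans ltvx (ltxY _ uY uv).
  rewrite /chain /= X'E YE /=; apply/andP; split.
    apply/simple_pairP; exists v; apply/setP => u; rewrite !inE.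
    by apply/andP/eqP => [[]|->] //; apply: X'Y.
  apply/beforeP => a b aX bY; apply: (@leq_trans (rank s x)).
    have [->|av] := eqVneq a v; first by rewrite r'v.
    rewrite r'o //; first exact: leq_trans (X'le _ aX) (ltnW ltvx).
    by apply: contraNneq xX' => <-.
  by have /and4P[_ _ _ /beforeP bXY] := chXY; rewrite -r'v; apply: bXY.
have [ecx|cx] := eqVneq c x.
  (* The vertices ranked from [x] on are exactly [x |: (Y :\ v)]; this set contains [Y'] and has the
     same size. *)
  subst c; suff e : x |: (Y :\ v) = Y' by rewrite e.
  apply/esym/eqP; rewrite eqEcard; apply/andP; split; last first.
    by rewrite (uE Y'E) -(uE YE) cardsU1 !inE (negPf xY) andbF (cardsD1 v Y) vY.
  apply/subsetP => u uY'; rewrite !inE; have [//|ux /=] := eqVneq u x.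
  have := Y'ge _ uY'; rewrite leqNgt; apply: contraR; rewrite negb_and negbK.
  have [->|uv /= uY] := eqVneq u v; first by rewrite ltvx.
  exact: ltn_trans (lt0v _ uY ux) ltvx.
(* If [(X', Y')] were [(X, Y)], then [v] would lie in both [X'] and [Y'], hence could be neither
   after nor before [c], although [c] differs from [v]. *)
suff /(chain_uniq chXY)[eX eY] : chain E s' (X', Y').
  have [cY|cY] := boolP (c \in Y).
    have := Y'ge v; rewrite -eY vY => /(_ isT).
    by rewrite leqNgt (ltn_trans ltvx (ltxY _ cY cv)).
  have := X'le v; rewrite -eX vX => /(_ isT).
  by rewrite leqNgt lt0v.
rewrite /chain /= X'E Y'E sp'; apply/beforeP => a b aX' bY'.
(* As [v] and [x] are adjacent in [s], they lie on the same side of [c]: before it if [c] is in [Y],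
   after it otherwise. Swapping them moves no vertex across [c]. *)
have [cY|cY] := boolP (c \in Y).
  have ltxc := ltxY _ cY cv; have ltvc := ltn_trans ltvx ltxc.
  have r'b : rank s' b = rank s b.
    by apply: r'o; apply: contraTneq (Y'ge _ bY') => ->; rewrite -ltnNge.
  rewrite r'b; apply: leq_trans (Y'ge _ bY').
  have [->|av] := eqVneq a v; first by rewrite r'v ltnW.
  have [->|ax] := eqVneq a x; first by rewrite r'x ltnW.
  by rewrite r'o // X'le.
have ltcv := lt0v _ cY cx; have ltcx := ltn_trans ltcv ltvx.
have r'a : rank s' a = rank s a.
  by apply: r'o; apply: contraTneq (X'le _ aX') => ->; rewrite -ltnNge.
rewrite r'a; apply: (leq_trans (X'le _ aX')).
have [->|bv] := eqVneq b v; first by rewrite r'v ltnW.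
have [->|bx] := eqVneq b x; first by rewrite r'x ltnW.
by rewrite r'o // Y'ge.
Qed.

(** Keeping a simple pair with the same union lets exchanges be iterated. If [u] is the common
    vertex, one exchange suffices and [Y] stays; otherwise three exchanges trade [u] and [z] between
    the edges. *)
Lemma simple_exchange X Y u z :
  X \in E -> Y \in E -> simple_pair X Y -> u \in X -> z \in Y -> z \notin X ->
  z |: (X :\ u) \in E /\
  exists Y', [/\ Y' \in E, simple_pair (z |: (X :\ u)) Y'
               & (z |: (X :\ u)) :|: Y' = X :|: Y].
Proof.
move=> XE YE /simple_pairP[v XYv] uX zY zX.
have [vX vY] : v \in X /\ v \in Y by apply/setIP; rewrite XYv inE.
have XY w : w \in X -> w \in Y -> w = v.
  by move=> wX wY; apply/set1P; rewrite -XYv inE wX.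
have YXv : Y :&: X = [set v] by rewrite setIC.
have zv : z != v by apply: contraNneq zX => ->.
have [euv|uv] := eqVneq u v.
  subst u; split; first exact: (edge_exchange YE XE).
  exists Y; split=> //.
    apply/simple_pairP; exists z; apply/setP => w; rewrite !inE.
    have [->|wz] := eqVneq w z; first by rewrite zY.
    have [//|wv /=] := eqVneq w v.
    by apply/negP => /andP[wX wY]; rewrite (XY _ wX wY) eqxx in wv.
  apply/setP => w; rewrite !inE.
  have [->|wz] := eqVneq w z; first by rewrite zY !orbT.
  by have [->|wv] := eqVneq w v; rewrite ?vY ?orbT ?andbT.
have uY : u \notin Y by apply: contra uv => uY; apply/eqP/XY.
have uz : u != z by apply: contraNneq zX => <-.
(* First [u] replaces [v] in [Y], making [u] the common vertex; then [z] replaces [u] in [X];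
   finally [v] replaces [z] in the second edge, restoring [v] as common vertex. *)
have Y1E := edge_exchange XE YE XYv uX uv.
set Y1 := _ |: _ in Y1E.
have XY1 : X :&: Y1 = [set u].
  apply/setP => w; rewrite !inE; have [->|wu] := eqVneq w u; first by rewrite uX.
  by apply/negP => /and3P[wX /= wv wY]; rewrite (XY _ wX wY) eqxx in wv.
have Y1X : Y1 :&: X = [set u] by rewrite setIC.
have zY1 : z \in Y1 by rewrite !inE zv zY orbT.
have zu : z != u by rewrite eq_sym.
have X1E := edge_exchange Y1E XE Y1X zY1 zu.
set X1 := _ |: _ in X1E *.
have X1Y1 : X1 :&: Y1 = [set z].
  apply/setP => w; rewrite !inE; have [->|wz] := eqVneq w z.
    by rewrite zv zY orbT.
  have [//|wu /=] := eqVneq w u.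
  by apply/negP => /and3P[wX /= wv wY]; rewrite (XY _ wX wY) eqxx in wv.
have vX1 : v \in X1 by rewrite !inE vX (eq_sym v u) uv orbT.
have vz : v != z by rewrite eq_sym.
have Y2E := edge_exchange X1E Y1E X1Y1 vX1 vz.
split=> //; exists (v |: (Y1 :\ z)); split=> //.
  apply/simple_pairP; exists v; apply/setP => w; rewrite !inE.
  have [->|wv] := eqVneq w v; first by rewrite vX (eq_sym v u) uv orbT.
  have [//|wz /=] := eqVneq w z; have [//|wu /=] := eqVneq w u.
  by apply/negP => /andP[wX wY]; rewrite (XY _ wX wY) eqxx in wv.
apply/setP => w; rewrite !inE.
have [->|wv] := eqVneq w v; first by rewrite vX orbT.
have [->|wz] := eqVneq w z; first by rewrite zY !orbT.
by have [->|wu] := eqVneq w u; rewrite ?uX.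
Qed.

(** Induction on the size of [Z :\: X]: trading a vertex of [X :\: Z] for one of [Z :\: X] lowers it
    and preserves the union. *)
Lemma simple_pair_complete X Y (Z : {set V}) :
  X \in E -> Y \in E -> simple_pair X Y -> Z \subset X :|: Y -> #|Z| = n -> Z \in E.
Proof.
move=> XE YE sXY ZU cZ; have [k] := ubnP #|Z :\: X|.
elim: k X Y XE YE sXY ZU => // k IH X Y XE YE sXY ZU lek.
have cX := uE XE.
have [ZX|] := boolP (Z \subset X).
  suff e : Z = X by rewrite e.
  by apply/eqP; rewrite eqEcard ZX cZ cX leqnn.
move=> ZX; have XZ : ~~ (X \subset Z).
  apply: contra ZX => XZ; suff e : Z = X by rewrite e.
  by apply/esym/eqP; rewrite eqEcard XZ cZ cX leqnn.
have /subsetPn[z zZ zX] := ZX; have /subsetPn[u uX uZ] := XZ.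
have zY : z \in Y by have := subsetP ZU z zZ; rewrite inE (negPf zX).
have [X1E [Y1 [Y1E sX1 eU]]] := simple_exchange XE YE sXY uX zY zX.
apply: (IH _ _ X1E Y1E sX1); first by rewrite eU.
have : #|Z :\: (z |: (X :\ u))| <= #|(Z :\: X) :\ z|.
  apply/subset_leq_card/subsetP => w; rewrite !inE negb_or negb_and negbK.
  case/andP=> /andP[-> /orP[/eqP->|->]] wZ //.
  by rewrite wZ in uZ.
by rewrite (cardsD1 z (Z :\: X)) !inE zX zZ in lek; lia.
Qed.

End Exchange.

Theorem theorem1 (n : nat) (V : finType) (E : {set {set V}}) :
  1 <= n ->
  uniform n E ->
  ~ two_colorable E ->
  m2 E = n * 'C(2 * n - 1, n) ->
  contains_complete (2 * n - 1) n E.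
Proof.
move=> n0 uE ncE mE.
have one s := unique_chain s n0 uE ncE mE.
have [[X Y] /and4P[/= XE YE sXY _]] := exists_chain 1%g n0 uE ncE.
exists (X :|: Y); first exact: union_card (uE _ XE) (uE _ YE) sXY.
by move=> Z; apply: simple_pair_complete.
Qed.
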